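(* Let $n\geq 2$ be an even integer. Then there is no pseudo-real Riemann surface $S$ with $G_{n}\leq \mathrm{Aut}^{+}(S)$ and with some $\alpha\in \mathrm{Aut}(S)\setminus \mathrm{Aut}^{+}(S)$ such that $\alpha^{2}\in G_{n}$. In particular, there is no pseudo-real Riemann surface $S$ with $G_{n}=\mathrm{Aut}^{+}(S)$.
   Context: For $n\ge 2$, $G_{n}=\langle x,y : x^{4n}=y^{2}=1,\ yxy=x^{2n-1}\rangle$ is the generalized quasi-dihedral group of order $8n$. For a closed Riemann surface $S$, $\mathrm{Aut}(S)$ is the group of its conformal and anticonformal automorphisms and $\mathrm{Aut}^{+}(S)$ the subgroup of conformal ones. A closed Riemann surface is pseudo-real if it admits anticonformal automorphisms but no anticonformal involution.
   Formalization: The first claim additionally assumes that α normalizes G_n (G_n has index two in ⟨G_n,α⟩); without this it is false, e.g. for Aut(S)=Sym(8n)×C_4 and Aut⁺(S)=Sym(8n)×C_2. The claim for G_n=Aut⁺(S) is proved with no added hypothesis. *)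

(* Defs.v *)
From mathcomp Require Import all_boot all_order all_algebra all_fingroup.
From mathcomp Require Import complex.
From mathcomp Require Import all_classical all_reals.
From mathcomp Require Import topology normedtype derive.

Set Implicit Arguments.
Unset Strict Implicit.
Unset Printing Implicit Defensive.

Import Order.TTheory GRing.Theory Num.Theory.
Import numFieldNormedType.Exports.

Local Open Scope classical_set_scope.
Local Open Scope ring_scope.
Local Open Scope complex_scope.

(* [derivable f z 1] is taken over the field R[i] itself, so it is complex
   differentiability at z. *)
Definition holomorphic_on (R : realType) (U : set R[i]^o)
    (f : R[i]^o -> R[i]^o) : Prop :=
  forall z, U z -> derivable f z 1.

Definition antiholomorphic_on (R : realType) (U : set R[i]^o)
    (f : R[i]^o -> R[i]^o) : Prop :=
  holomorphic_on U (fun z => (f z)^*).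

(* A homeomorphism from an open subset of S onto an open subset of the complex
   plane; [to_plane] is meaningful only on [cdom], [of_plane] only on
   [cimage]. *)
Record chart (R : realType) (S : topologicalType) := Chart {
  cdom : set S;
  to_plane : S -> R[i]^o;
  of_plane : R[i]^o -> S;
  cimage := to_plane @` cdom;
  cdom_open : open cdom;
  cimage_open : open cimage;
  to_planeK : {in cdom, cancel to_plane of_plane};
  to_plane_continuous : {within cdom, continuous to_plane};
  of_plane_continuous : {within cimage, continuous of_plane}
}.

(* Second countability is not required separately: it follows from compactness
   and the existence of charts. *)
Record closed_riemann_surface (R : realType) := ClosedRiemannSurface {
  carrier :> topologicalType;
  atlas : set (chart R carrier);
  surface_nonempty : [set: carrier] !=set0;
  surface_hausdorff : hausdorff_space carrier;
  surface_compact : compact [set: carrier];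
  surface_connected : connected [set: carrier];
  atlas_cover : \bigcup_(c in atlas) cdom c = [set: carrier];
  atlas_compatible : forall c d, atlas c -> atlas d ->
    holomorphic_on (to_plane c @` (cdom c `&` cdom d))
                   (to_plane d \o of_plane c)
}.

Section Automorphisms.
Context (R : realType) (S : closed_riemann_surface R).
Implicit Types (f g : S -> S) (G : set (S -> S)).

Definition holomorphic_map f : Prop :=
  continuous f /\
  forall c d, atlas c -> atlas d ->
    holomorphic_on (to_plane c @` (cdom c `&` f @^-1` cdom d))
                   (to_plane d \o f \o of_plane c).

Definition antiholomorphic_map f : Prop :=
  continuous f /\
  forall c d, atlas c -> atlas d ->
    antiholomorphic_on (to_plane c @` (cdom c `&` f @^-1` cdom d))
                       (to_plane d \o f \o of_plane c).

Definition conformal_automorphism f : Prop :=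
  exists g, [/\ cancel f g, cancel g f, holomorphic_map f & holomorphic_map g].

Definition anticonformal_automorphism f : Prop :=
  exists g, [/\ cancel f g, cancel g f,
                antiholomorphic_map f & antiholomorphic_map g].

(* Aut^+(S) and Aut(S), as groups of self-maps of S under composition. *)
Definition conformal_Aut : set (S -> S) := [set f | conformal_automorphism f].

Definition full_Aut : set (S -> S) :=
  [set f | conformal_automorphism f \/ anticonformal_automorphism f].

(* An anticonformal map is never the identity, so [involutive] already means
   that it has order exactly 2. *)
Definition pseudo_real : Prop :=
  (exists f, anticonformal_automorphism f) /\
  ~ (exists f, anticonformal_automorphism f /\ involutive f).

(* G is, under composition, a group isomorphic to
   <x, y : x^(4n) = y^2 = 1, y x y = x^(2n-1)>. *)
Definition is_generalized_quasi_dihedral (n : nat) G : Prop :=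
  exists (gT : finGroupType) (phi : gT -> S -> S),
    [/\ (finset.setTfor gT \isog Grp (x : y : x ^+ (4 * n), y ^+ 2,
                                               y * x * y = x ^+ (2 * n - 1)))%g,
        phi 1%g = id,
        forall a b, phi (a * b)%g = phi a \o phi b,
        injective phi &
        range phi = G].

(* If f o f lies in the group G, this says that G has index at most two in the
   group generated by G and f; it is automatic when G is all of Aut^+(S) and
   f is an automorphism of S.  Without it there are pseudo-real surfaces with
   G_n <= Aut^+(S) and an anticonformal alpha whose square lies in G_n: for
   example Aut(S) = Sym(8n) x C_4 and Aut^+(S) = Sym(8n) x C_2, where G_n is
   embedded by its regular representation and the character x |-> 1, y |-> -1,
   and alpha = (l, i) with l^2 the regular image of y. *)
Definition normalizes f G : Prop :=
  [set f \o g | g in G] = [set g \o f | g in G].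

End Automorphisms.

Arguments conformal_Aut {R} S.
Arguments full_Aut {R} S.

(* Main.v *)
(* Write theta for conjugation by alpha on G and a = alpha^2. For g in G,
   (alpha g)^2 = a theta(g) g, so it suffices to solve a theta(g) g = 1 in G:
   then alpha g is an anticonformal involution. Since <x> is characteristic in
   G_n, theta x = x^r and theta y = x^s y; comparing theta^2 with conjugation by
   a, and theta a with a, forces a = x^k (this uses that -1 is not a square
   modulo 4) and gives congruences on r, s, k modulo 4n. For n even these
   congruences always allow a solution g = x^j or g = x^j y. *)

Require Import Defs.
From mathcomp Require Import all_boot all_order all_algebra all_fingroup.
From mathcomp Require Import cyclic extremal zify ring.

(** * The presented group: order of [x], normal form, conjugation rule *)

Section QuasiDihedral.
Set Implicit Arguments.
Unset Strict Implicit.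
Unset Printing Implicit Defensive.
Import GroupScope.

(* The semidirect product of C_(4n) by C_2, which shows that x has order exactly
   4n in the presented group. *)
Lemma gqd_model (n : nat) : (2 <= n)%N ->
  exists (rT : finGroupType) (x y : rT),
   [/\ #|[set: rT]| = (8 * n)%N, [set: rT] = <[x]> <*> <[y]>, x ^+ (4 * n) = 1,
       y ^+ 2 = 1 & y * x * y = x ^+ (2 * n - 1)].
Proof.
move=> n2; pose b : 'Z_(4 * n)%N := Zp1; pose e := (2 * n - 1)%N.
have q1 : (1 < 4 * n)%N by lia.
have ob : #[b] = (4 * n)%N by rewrite order_Zp1 Zp_cast.
(* As [e * e] is 1 modulo [4 * n], the [e]-th power map on [<[b]>] is its own inverse. *)
have ee : (e * e = 1 + (n - 1) * (4 * n))%N by rewrite /e; nia.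
have bee : b ^+ (e * e) = b.
  have b1 : b ^+ (4 * n) = 1 by rewrite -[X in _ ^+ X]ob expg_order.
  by rewrite ee expgD (mulnC (n - 1)%N) expgM b1 expg1n mulg1.
have zee : {in <[b]>, forall z, z ^+ e ^+ e = z}.
  by move=> _ /cycleP[i ->]; rewrite -2!expgM (mulnC i) expgM bee.
have injf : 'injm (cyclem e b).
  apply/injmP=> z t bz bt /= ezt.
  by rewrite -(zee z) // -(zee t) //; congr (_ ^+ e).
have imf : cyclem e b @* <[b]> = <[b]>.
  apply/eqP; rewrite eqEcard card_injm // leqnn andbT.
  by apply/subsetP => _ /morphimP[z _ zb ->]; rewrite groupX.
pose s := aut injf imf.
have sE : s b = b ^+ e by rewrite autE ?cycle_id.
have sA : s \in Aut <[b]> by apply: Aut_aut.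
have s2 : #[s] %| 2.
  rewrite order_dvdn; apply/eqP/(@eq_Aut _ <[b]>); rewrite ?groupX ?group1 //.
  move=> z bz; rewrite perm1 expgS expg1 permM.
  have -> : s z = z ^+ e by exact: autE.
  by rewrite autE ?groupX //=; exact: zee.
have := Extremal.Grp (isT : (1 < 2)%N) q1 (ex_intro _ s (And3 sA s2 sE)).
move=> /isoGrp_hom/existsP[[x y]] /=; rewrite !xpair_eqE /=.
case/and4P=> /eqP gen /eqP xq /eqP y2 /eqP xy.
exists (Extremal.gtype (4 * n)%N 2 e), x, y; split=> //.
  by rewrite Extremal.card //; lia.
have yV : y^-1 = y by apply/eqP; rewrite eq_invg_mul -(expgS _ 1) y2.
by rewrite -xy conjgE yV mulgA.
Qed.

(** The relations bound the orders of [x] and [y] by [4 * n] and 2; the model of order [8 * n] is a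
    quotient of the group, so [#[x]] cannot be smaller. *)
Lemma gqd_generators (gT : finGroupType) (n : nat) :
  (2 <= n)%N ->
  [set: gT] \isog Grp (x : y : x ^+ (4 * n), y ^+ 2,
                               y * x * y = x ^+ (2 * n - 1)) ->
  exists x y : gT,
   [/\ [set: gT] = <[x]> * <[y]>, #[x] = (4 * n)%N,
       y ^+ 2 = 1 & y * x * y = x ^+ (2 * n - 1)].
Proof.
move=> n2 iso.
have /existsP[[x y]] /= := isoGrp_hom iso; rewrite !xpair_eqE /=.
case/and4P=> /eqP gen /eqP xq /eqP y2 /eqP xy.
have yV : y^-1 = y by apply/eqP; rewrite eq_invg_mul -(expgS _ 1) y2.
have xyJ : x ^ y = x ^+ (2 * n - 1) by rewrite conjgE yV mulgA.
have nxy : <[y]> \subset 'N(<[x]>).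
  by rewrite norms_cycle xyJ mem_cycle.
have genM : [set: gT] = <[x]> * <[y]> by rewrite -gen norm_joinEr.
exists x, y; split=> //.
have [rT [x' [y' [oH genH xq' y2' xy']]]] := gqd_model n2.
have : [set: rT] \homg [set: gT].
  rewrite iso; apply/existsP; exists (x', y'); rewrite /= !xpair_eqE.
  by rewrite -genH xq' y2' xy' !eqxx.
move=> /card_homg/(dvdn_leq (cardG_gt0 _)); rewrite oH => leG.
have leM : (#|[set: gT]| <= #[x] * #[y])%N by rewrite genM mul_cardG leq_pmulr.
have ley : (#[y] <= 2)%N by apply: dvdn_leq => //; rewrite order_dvdn y2.
have lex : (#[x] <= 4 * n)%N by apply: dvdn_leq; rewrite ?order_dvdn ?xq //; lia.
have := leq_trans leG (leq_trans leM (leq_mul (leqnn #[x]) ley)).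
by move: lex; lia.
Qed.

Lemma gqd_normal_form (gT : finGroupType) (x y : gT) :
  [set: gT] = <[x]> * <[y]> -> y ^+ 2 = 1 ->
  forall g : gT, exists i : nat, g = x ^+ i \/ g = x ^+ i * y.
Proof.
move=> genM y2 g; have /mulsgP[_ _ /cycleP[i ->] /cycleP[j ->] ->] :
  g \in <[x]> * <[y]> by rewrite -genM inE.
exists i; rewrite -(odd_double_half j) -muln2 mulnC expgD expgM y2 expg1n mulg1.
by case: (odd j); rewrite ?expg1 ?mulg1; [right | left].
Qed.

Lemma gqd_conj_pow (gT : finGroupType) (n : nat) (x y : gT) :
  y ^+ 2 = 1 -> y * x * y = x ^+ (2 * n - 1) ->
  forall i, y * x ^+ i = x ^+ (i * (2 * n - 1)) * y.
Proof.
move=> y2 yxy i.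
have yV : y^-1 = y by apply/eqP; rewrite eq_invg_mul -(expgS _ 1) y2.
have xJ : x ^ y = x ^+ (2 * n - 1) by rewrite conjgE yV mulgA.
by rewrite mulnC expgM -xJ -conjXg conjgE yV -!mulgA -(expgS _ 1) y2 mulg1.
Qed.

End QuasiDihedral.

(** * Solving [a * theta g * g = 1] in the group *)

Section TwistedSquare.
Set Implicit Arguments.
Unset Strict Implicit.
Unset Printing Implicit Defensive.
Import GRing.Theory GroupScope.
Local Open Scope ring_scope.

Lemma eq_expg_dvdz (gT : finGroupType) (x : gT) (i j : nat) :
  (x ^+ i = x ^+ j)%g <-> (#[x]%:Z %| i%:Z - j%:Z)%Z.
Proof.
rewrite -eqz_mod_dvd !modz_nat eqz_nat -eq_expg_mod_order.
by split => /eqP.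
Qed.

(* With r + 1 = 2u, k = 2k' and s = 2s', one of -k', -k' + n, k' + s',
   k' + s' + n is a suitable j: the first two in the first alternative, the last
   two in the second one, adding n serving to correct the residue modulo 4n by
   2n. *)
Lemma exponent_solution (n r k s : int) : (2 %| n)%Z -> (2 %| s)%Z ->
  (4 * n %| r * r - 1)%Z -> (4 * n %| k * (r - 1))%Z ->
  (4 * n %| s * (r + 1) - k * (2 * n - 2))%Z ->
  exists j : int, (4 * n %| k + j * (r + 1))%Z \/
                  (4 * n %| k + s + j * (r + 2 * n - 1))%Z.
Proof.
move=> /dvdzP[m ->] /dvdzP[s' ->] /dvdzP[q1 r2] /dvdzP[q2 kr] /dvdzP[q3 sr].
have [u ru] : exists u : int, r = u * 2 - 1.
  have [e [re|re]] : exists e : int, r = e * 2 \/ r = e * 2 - 1.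
  - by exists ((r + 1) %/ 2)%Z; lia.
  - by move: r2; rewrite re => r2; exfalso; nia.
  - by exists e.
(* Here [k] is even because [sr] makes [2 * k] a multiple of 4. *)
have [k' kk] : exists k' : int, k = k' * 2.
  by exists (k %/ 2)%Z; move: sr; rewrite ru => sr; nia.
subst r k.
have ku : (k' * (u - 1) = 2 * m * q2) by nia.
have su : (s' * u = k' * (2 * m - 1) + 2 * m * q3) by nia.
have parity (z : int) : exists w : int, z = w * 2 \/ z = w * 2 + 1.
  by exists (z %/ 2)%Z; lia.
(* At [j = - k'] the first expression is [- 4 * m * q2], a multiple of [8 * m] when [q2] is even.
   Shifting [j] by [2 * m] adds [4 * m * u], which repairs the case of [q2] and [u] both odd. *)
have [w [qw|qw]] := parity q2.
  exists (- k'); left; apply/dvdzP; exists (- w).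
  have -> : (k' * 2 + - k' * (u * 2 - 1 + 1) = - 2 * (k' * (u - 1))) by ring.
  by rewrite ku qw; ring.
have [v [uv|uv]] := parity u; last first.
  exists (- k' + 2 * m); left; apply/dvdzP; exists (v - w).
  have -> : (k' * 2 + (- k' + 2 * m) * (u * 2 - 1 + 1) =
             - 2 * (k' * (u - 1)) + 4 * m * u) by ring.
  by rewrite ku qw uv; ring.
have total : (k' * 2 + s' * 2 + (k' + s') * (u * 2 - 1 + 2 * (m * 2) - 1) =
              4 * m * (q2 + q3 + 2 * k' + s')).
  have -> : (k' * 2 + s' * 2 + (k' + s') * (u * 2 - 1 + 2 * (m * 2) - 1) =
     2 * (k' * (u - 1)) + 2 * k' + 2 * (s' * u) + 4 * m * (k' + s')) by ring.
  by rewrite ku su; ring.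
have [t [tt|tt]] := parity (q2 + q3 + 2 * k' + s').
  by exists (k' + s'); right; apply/dvdzP; exists t; rewrite total tt; ring.
(* As [u] is even, the shift by [2 * m] adds [4 * m * (u - 1 + 2 * m)], an odd multiple of
   [4 * m]. *)
exists (k' + s' + 2 * m); right; apply/dvdzP; exists (t + v + m).
by rewrite mulrDl addrA total tt uv; ring.
Qed.

Lemma nat_representative (j : int) (d : nat) : (0 < d)%N ->
  exists (k : nat) (q : int), k%:Z = j + q * d%:Z.
Proof.
move=> d_gt0; exists `|(j %% d%:Z)%Z|%N, (- (j %/ d%:Z)%Z).
by rewrite gez0_abs ?modz_ge0 ?mulNr // eqz_nat -lt0n.
Qed.

Lemma gqd_twisted_square (gT : finGroupType) (n : nat)
    (theta : gT -> gT) (a : gT) : (2 <= n)%N -> ~~ odd n ->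
  ([set: gT] \isog Grp (x : y : x ^+ (4 * n), y ^+ 2,
                               y * x * y = x ^+ (2 * n - 1)))%g ->
  {morph theta : g h / (g * h)%g} -> theta a = a ->
  (forall g, theta (theta g) = g ^ a)%g ->
  exists g, (a * theta g * g)%g = 1%g.
Proof.
move=> n2 n_even iso thetaM theta_a theta2.
have n4 : (0 < 4 * n)%N by lia.
have [x [y [genM ox y2 yxy]]] := gqd_generators n2 iso.
have form := gqd_normal_form genM y2.
have yX := gqd_conj_pow y2 yxy.
have ox_dvd (i j : nat) : (x ^+ i = x ^+ j)%g <-> (4%:Z * n%:Z %| i%:Z - j%:Z)%Z.
  by have := eq_expg_dvdz x i j; rewrite ox PoszM.
have theta1 : theta 1%g = 1%g.
  by apply: (mulgI (theta 1%g)); rewrite -thetaM !mulg1.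
have theta_inj : injective theta.
  by move=> g h /(congr1 theta); rewrite !theta2 => /conjg_inj.
have thetaX g i : theta (g ^+ i)%g = (theta g ^+ i)%g.
  by elim: i => [|i IH]; rewrite ?theta1 // !expgS thetaM IH.
have yy : (y * y = 1)%g by rewrite -y2 expgS expg1.
have e_int : (2 * n - 1)%N%:Z = 2 * n%:Z - 1 by lia.
have sq i : ((x ^+ i * y) ^+ 2 = x ^+ (2 * n * i))%g.
  rewrite expgS expg1 mulgA -(mulgA _ y) yX -!mulgA yy mulg1 -expgD.
  by congr (_ ^+ _)%g; nia.
have yNx i : y <> (x ^+ i)%g.
  move=> yi; have := yX 1%N; rewrite expg1 mul1n yi -expgSr -expgD => /ox_dvd.
  by move=> /dvdzP[q]; nia.
have [r tx] : exists r : nat, theta x = (x ^+ r)%g.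
  (* An element [x ^+ r * y] has fourth power 1, whereas [x] has order [4 * n >= 8]. *)
  have [r [|tx]] := form (theta x); first by exists r.
  have : (theta x ^+ 4 = 1)%g.
    rewrite tx (expgM _ 2 2) sq -expgM -(expg0 x).
    by apply/ox_dvd/dvdzP; exists r%:Z; lia.
  rewrite -thetaX -theta1 => /theta_inj; rewrite -(expg0 x) => /ox_dvd/dvdzP[q].
  by have [|] : (q <= 0) \/ (1 <= q); [lia|nia|nia].
have [s ty] : exists s : nat, theta y = (x ^+ s * y)%g.
  (* If [theta y] were a power of [x], it would commute with [theta x], and then [y] with [x]. *)
  have [s [ty|ty]] := form (theta y); last by exists s.
  have : theta (x * y)%g = theta (y * x)%g by rewrite !thetaM tx ty -!expgD addnC.
  move=> /theta_inj xy; have := yX 1%N; rewrite expg1 mul1n -xy => /mulIg.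
  by rewrite -{1}(expg1 x) => /ox_dvd/dvdzP[q]; nia.
have s_even : (2 %| s%:Z)%Z.
  have : theta (y ^+ 2)%g = 1%g by rewrite y2.
  rewrite thetaX ty sq -(expg0 x) => /ox_dvd/dvdzP[q sq'].
  by apply/dvdzP; exists q; nia.
have n_even' : (2 %| n%:Z)%Z by apply/dvdzP; exists (n./2)%:Z; lia.
have aC g : (a * theta (theta g) = g * a)%g by rewrite theta2 -conjgC.
have [k ak] : exists k : nat, a = (x ^+ k)%g.
  (* For [a = x ^+ k * y], [theta2] at [x] gives [r * r * (2 * n - 1) = 1] modulo [4 * n], hence
     [r * r = -1] modulo 4 as [n] is even. *)
  have [k [|ak]] := form a; first by exists k.
  have := aC x; rewrite tx thetaX tx -expgM ak -mulgA yX !mulgA => /mulIg.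
  rewrite -expgD -expgS => /ox_dvd/dvdzP[q].
  move: n_even' => /dvdzP[m ->] e; exfalso.
  have [t [rt|rt]] : exists t : nat, r = (t * 2)%N \/ r = (t * 2 + 1)%N.
  - by exists (r./2); lia.
  - by subst r; nia.
  - by subst r; nia.
have r2 : (4%:Z * n%:Z %| r%:Z * r%:Z - 1)%Z.
  have := aC x; rewrite tx thetaX tx -expgM ak -expgD -expgS => /ox_dvd.
  by congr (_ %| _)%Z; lia.
have kr : (4%:Z * n%:Z %| k%:Z * (r%:Z - 1))%Z.
  move: theta_a; rewrite ak thetaX tx -expgM => /ox_dvd.
  by congr (_ %| _)%Z; lia.
have sr : (4%:Z * n%:Z %| s%:Z * (r%:Z + 1) - k%:Z * (2 * n%:Z - 2))%Z.
  have := aC y; rewrite ty thetaM thetaX tx ty -expgM ak yX !mulgA => /mulIg.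
  by rewrite -!expgD => /ox_dvd; congr (_ %| _)%Z; nia.
have [j0 jj0] := exponent_solution n_even' s_even r2 kr sr.
(* Exponents of [x] matter only modulo [4 * n], so the integer solution is shifted to a natural
   number. *)
have [j [q jq]] : exists (j : nat) (q : int), j%:Z = j0 + q * (4 * n%:Z).
  by have [j [q jq]] := nat_representative j0 n4; exists j, q; rewrite jq PoszM.
case: jj0 => /dvdzP[p pj].
  exists (x ^+ j)%g; rewrite thetaX tx ak -expgM -!expgD -(expg0 x).
  apply/ox_dvd/dvdzP; exists (p + q * (r%:Z + 1)).
  by rewrite mulrDl -pj !PoszD PoszM jq; ring.
exists (x ^+ j * y)%g; rewrite thetaM thetaX tx ty ak -expgM.
rewrite !mulgA -(mulgA _ y) yX !mulgA -mulgA yy mulg1 -!expgD -(expg0 x).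
apply/ox_dvd/dvdzP; exists (p + q * (r%:Z + 2 * n%:Z - 1)).
by rewrite mulrDl -pj !PoszD !PoszM e_int jq; ring.
Qed.

End TwistedSquare.

From mathcomp Require Import complex.
From mathcomp Require Import all_classical all_reals.
From mathcomp Require Import topology normedtype derive.

(** * Complex differentiability under conjugation and composition *)

Section Analysis.
Set Implicit Arguments.
Unset Strict Implicit.
Unset Printing Implicit Defensive.
Import Order.TTheory GRing.Theory Num.Theory.
Import numFieldNormedType.Exports.
Local Open Scope classical_set_scope.
Local Open Scope ring_scope.
Local Open Scope complex_scope.
Context (R : realType).
Implicit Types (f g : R[i]^o -> R[i]^o) (z : R[i]^o).

(** The boolean lets one argument treat holomorphic and antiholomorphic maps together. *)
Definition conj_if (b : bool) (z : R[i]^o) : R[i]^o := if b then z^* else z.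

Lemma conj_ifK b : involutive (conj_if b).
Proof. by case: b => z //=; exact: conjcK. Qed.

Lemma conj_if_continuous b : continuous (conj_if b).
Proof.
case: b => //= z A /nbhs_ballP[e /= e0 zA]; apply/nbhs_ballP; exists e => //= t zt.
by apply: zA; rewrite /ball /= -[X in `|X|](raddfB (@conjc R)) normcJ.
Qed.

(** Conjugation is continuous, injective and fixes 0; this allows the change of increment in a
    difference quotient. *)
Lemma conj_if_punctured :
  conj_if true x @[x --> 0^'] --> (0^' : set_system R[i]^o).
Proof.
move=> A; rewrite /dnbhs /= => A0.
have conj_0 : conj_if true 0 = 0 by exact: conjc0.
have A0' : nbhs (conj_if true 0) [set x | x != 0 -> A x] by rewrite conj_0.
have : nbhs (0 : R[i]^o) (conj_if true @^-1` [set x | x != 0 -> A x]) :=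
  conj_if_continuous A0'.
apply: filterS => x Ax x0; apply: Ax; apply: contra x0 => /eqP x0.
by apply/eqP; have := conj_ifK true x; rewrite x0 => <-; exact: conj_0.
Qed.

Lemma derivable_conj_if b f z :
  derivable f z 1 -> derivable (conj_if b \o f \o conj_if b) (conj_if b z) 1.
Proof.
(* Schwarz reflection: the difference quotient of [conj \o f \o conj] at
   [conj z] is the conjugate of that of [f] at [z], with a conjugated increment. *)
case: b; last by move=> fz; exact: fz.
move=> /cvg_ex[l fl]; apply/cvg_ex; exists (conj_if true l).
have conj_fl := cvg_comp _ _ fl (@conj_if_continuous true l).
have := cvg_comp _ _ conj_if_punctured conj_fl.
apply: cvg_trans; apply: near_eq_cvg; apply: nearW => h /=.
have conjA (u : R[i]) : ((u%:A : R[i]^o) + z^*%C)^*%C = (u^*%C)%:A + z.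
  by rewrite /GRing.scale /= !mulr1 (raddfD (@conjc R)) /= conjcK.
have conjS (u v : R[i]) : (u^-1 *: (v : R[i]^o))^*%C = u^*%C^-1 * v^*%C.
  by rewrite /GRing.scale /= (rmorphM (@conjc R)) /= conjc_inv.
by rewrite conjA conjS !conjcK (raddfB (@conjc R)).
Qed.

Lemma derivable_comp f g z :
  derivable g z 1 -> derivable f (g z) 1 -> derivable (f \o g) z 1.
Proof.
move=> /derivable1_diffP dg /derivable1_diffP df; apply/derivable1_diffP.
exact: (@differentiable_comp _ R[i]^o R[i]^o R[i]^o g f z dg df).
Qed.

End Analysis.

(** * Conformal and anticonformal maps of the surface *)

Section Maps.
Set Implicit Arguments.
Unset Strict Implicit.
Unset Printing Implicit Defensive.
Import Order.TTheory GRing.Theory Num.Theory.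
Import numFieldNormedType.Exports.
Local Open Scope classical_set_scope.
Local Open Scope ring_scope.
Local Open Scope complex_scope.
Context (R : realType) (S : closed_riemann_surface R).
Implicit Types (f g : S -> S).

(* [dianalytic false] unfolds to [holomorphic_map] and [dianalytic true] to
   [antiholomorphic_map]. *)
Definition dianalytic (b : bool) f : Prop :=
  continuous f /\ forall c d, atlas c -> atlas d ->
    holomorphic_on (to_plane c @` (cdom c `&` f @^-1` cdom d))
                   (conj_if b \o (to_plane d \o f \o of_plane c)).

Lemma of_plane_cvg (c : chart R S) p :
  cdom c p -> {for to_plane c p, continuous (of_plane c)}.
Proof.
move=> cp.
have cont := @of_plane_continuous _ _ c.
rewrite continuous_open_subspace in cont; last exact: cimage_open.
by apply: cont; rewrite inE; exists p.
Qed.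

(** Chain rule through a chart [e] around [g p]; conjugations cancel in pairs, so the types add
    modulo 2. *)
Lemma dianalytic_comp b1 b2 f g :
  dianalytic b1 f -> dianalytic b2 g -> dianalytic (b2 (+) b1) (f \o g).
Proof.
move=> [cf hf] [cg hg]; split.
  by move=> p; apply: continuous_comp; [exact: cg | exact: cf].
move=> c d ac ad _ [p [cp dp] <-].
have [e ae ep] : (\bigcup_(e in @atlas R S) cdom e) (g p) by rewrite atlas_cover.
have pK q h : cdom h q -> of_plane h (to_plane h q) = q.
  by move=> hq; rewrite to_planeK // inE.
have dg := hg c e ac ae (to_plane c p) (ex_intro2 _ _ p (conj cp ep) erefl).
have df := hf e d ae ad (to_plane e (g p))
  (ex_intro2 _ _ (g p) (conj ep dp) erefl).
(* conj_if (b2 (+) b1) \o F \o G = (conj_if b2 \o conj_if b1 \o F \o conj_if b2)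
   \o (conj_if b2 \o G) *)
have df' := @derivable_conj_if _ b2 _ _ df.
have ew : (conj_if b2 \o (to_plane e \o g \o of_plane c)) (to_plane c p) =
          conj_if b2 (to_plane e (g p)).
  by rewrite /= pK.
rewrite -ew in df'.
apply: near_eq_derivable (derivable_comp dg df').
have ge : {for to_plane c p, continuous (g \o of_plane c)}.
  by apply: continuous_comp; [exact: of_plane_cvg | exact: cg].
(* The factorization through [e] is valid only where [g] lands in [cdom e], which holds near the
   point. *)
have : \forall t \near to_plane c p, cdom e (g (of_plane c t)).
  apply: ge; apply: open_nbhs_nbhs; split; first exact: cdom_open.
  by rewrite /= pK.
apply: filterS => t te /=.
rewrite conj_ifK pK //.
by case: b1 b2 {hf hg dg df df' ew} => -[]; rewrite /= ?conjcK.
Qed.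

Definition dianalytic_automorphism (b : bool) f : Prop :=
  exists g, [/\ cancel f g, cancel g f, dianalytic b f & dianalytic b g].

Lemma conformal_automorphismE f :
  conformal_automorphism f = dianalytic_automorphism false f.
Proof. by rewrite /conformal_automorphism /dianalytic_automorphism. Qed.

Lemma anticonformal_automorphismE f :
  anticonformal_automorphism f = dianalytic_automorphism true f.
Proof. by rewrite /anticonformal_automorphism /dianalytic_automorphism. Qed.

Lemma dianalytic_automorphism_comp b1 b2 f g :
  dianalytic_automorphism b1 f -> dianalytic_automorphism b2 g ->
  dianalytic_automorphism (b2 (+) b1) (f \o g).
Proof.
move=> [f' [fK f'K hf hf']] [g' [gK g'K hg hg']]; exists (g' \o f').
split; [exact: can_comp | exact: can_comp | exact: dianalytic_comp |].
by rewrite addbC; exact: dianalytic_comp.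
Qed.

(** Normalization defines [theta] by [phi g \o alpha = alpha \o phi (theta g)]. The square of
    [alpha \o phi g] is then [phi (a * theta g * g)], so a solution of the twisted equation yields
    the involution. *)
Lemma anticonformal_involution (n : nat) (G : set (S -> S)) (alpha : S -> S) :
  (2 <= n)%N -> ~~ odd n ->
  is_generalized_quasi_dihedral n G -> G `<=` conformal_Aut S ->
  anticonformal_automorphism alpha ->
  G (alpha \o alpha) -> normalizes alpha G ->
  exists f, anticonformal_automorphism f /\ involutive f.
Proof.
move=> n2 n_even [gT [phi [iso phi1 phiM phi_inj rangeG]]] GAut anti.
rewrite -rangeG => -[a _ phia] norm.
have [alpha' [alphaK _ _ _]] := anti.
have alpha_inj (g h : gT) : alpha \o phi g = alpha \o phi h -> g = h.
  move=> gh; apply: phi_inj; apply/funext => p; apply: (can_inj alphaK).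
  by have := congr1 (@^~ p) gh.
have /choice[theta thetaP] :
    forall g : gT, exists h : gT, phi g \o alpha = alpha \o phi h.
  move=> g; have : [set h \o alpha | h in range phi] (phi g \o alpha).
    by exists (phi g) => //; exists g.
  by rewrite -norm => -[_ [h _ <-] e]; exists h.
have thetaE (g : gT) p : alpha (phi (theta g) p) = phi g (alpha p).
  by have := congr1 (@^~ p) (thetaP g).
have phiaE p : alpha (alpha p) = phi a p by rewrite phia.
have [g ag1] : exists g : gT, (a * theta g * g)%g = 1%g.
  apply: (gqd_twisted_square n2 n_even iso).
  - move=> g h; apply: alpha_inj; apply/funext => p /=.
    by rewrite thetaE !phiM /= !thetaE.
  - by apply: alpha_inj; apply/funext => p /=; rewrite thetaE -!phiaE.
  - move=> g; apply: (mulgI a); rewrite -conjgC.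
    apply: phi_inj; apply/funext => p.
    by rewrite !phiM /= -!phiaE !thetaE.
have phig_aut : conformal_automorphism (phi g).
  by apply: GAut; rewrite -rangeG; exists g.
exists (alpha \o phi g); split.
  move: anti phig_aut; rewrite !anticonformal_automorphismE.
  rewrite conformal_automorphismE; exact: dianalytic_automorphism_comp.
move=> p /=; rewrite -thetaE phiaE.
by have := congr1 (@^~ p) (congr1 phi ag1); rewrite !phiM phi1.
Qed.

Lemma anticonformal_sqr f : anticonformal_automorphism f ->
  conformal_Aut S (f \o f).
Proof.
rewrite /conformal_Aut /= conformal_automorphismE anticonformal_automorphismE.
by move=> hf; exact: (dianalytic_automorphism_comp hf hf).
Qed.

(** Conjugation by [f] or by its inverse inserts two anticonformal factors, so it preserves
    conformality. *)
Lemma anticonformal_normalizes f : anticonformal_automorphism f ->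
  normalizes f (conformal_Aut S).
Proof.
move=> anti; have [f' [fK f'K hf hf']] := anti.
have anti' : anticonformal_automorphism f' by exists f.
have conjP g u v : conformal_automorphism g -> anticonformal_automorphism u ->
    anticonformal_automorphism v -> conformal_automorphism (u \o g \o v).
  rewrite !anticonformal_automorphismE !conformal_automorphismE => hg hu hv.
  exact: dianalytic_automorphism_comp (dianalytic_automorphism_comp hu hg) hv.
apply/seteqP; split => _ [g hg <-].
  exists (f \o g \o f'); first exact: conjP.
  by apply/funext => p /=; rewrite fK.
exists (f' \o g \o f); first exact: conjP.
by apply/funext => p /=; rewrite f'K.
Qed.

End Maps.

Local Open Scope classical_set_scope.

Theorem theorem5p9 (R : realType) (n : nat) (hn : (2 <= n)%N)
    (heven : ~~ odd n) :
  ~ (exists (S : closed_riemann_surface R) (G : set (S -> S)) (alpha : S -> S),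
       [/\ pseudo_real S,
           is_generalized_quasi_dihedral n G,
           G `<=` conformal_Aut S,
           (full_Aut S `\` conformal_Aut S) alpha &
           G (alpha \o alpha) /\ normalizes alpha G])
  /\
  ~ (exists S : closed_riemann_surface R,
       pseudo_real S /\ is_generalized_quasi_dihedral n (conformal_Aut S)).
Proof.
split.
- move=> [S [G [alpha [[_ no_inv] gqd GAut [[conf|anti] nconf] [sqr norm]]]]].
    by [].
  by apply: no_inv; exact: (anticonformal_involution hn heven gqd GAut anti).
(* With [G] all of [conformal_Aut S], any anticonformal [f] can serve as [alpha]. *)
- move=> [S [[[f anti] no_inv] gqd]]; apply: no_inv.
  exact: (anticonformal_involution hn heven gqd (@subset_refl _ _) anti
    (anticonformal_sqr anti) (anticonformal_normalizes anti)).
Qed.
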